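(* Let $F$ be a hyperfield such that the characteristic of the field $F/\alpha^*$ is not $2$, let $L$ be a Lie hyperalgebra over $F$, and let $n\ge1$. Then $L/\mathcal{S}_n^*$, with the quotient operations, is a solvable Lie algebra of length at most $n$ over $F/\alpha^*$.
   Context: **Hyperstructures.** $\mathscr{P}^*(H)$ is the set of non-empty subsets of $H$. A hyperoperation $\circ:H\times H\to\mathscr{P}^*(H)$ (and likewise any external map or hyperbracket with values in non-empty subsets) is extended to non-empty subsets by $A\circ B=\bigcup_{a\in A,b\in B}a\circ b$; elements are identified with singletons. $(H,\circ)$ is a semihypergroup if $\circ$ is associative, and a hypergroup if moreover $x\circ H=H\circ x=H$ for all $x\in H$. A hyperring $(R,+,\cdot)$: $(R,+)$ is a hypergroup, $(R,\cdot)$ a semihypergroup, and $\cdot$ is distributive over $+$. A hyperfield is a hyperring such that $(R,\cdot)$ (or $(R-\{0\},\cdot)$, if $R$ contains $0$) is a hypergroup. A hypervector space over a hyperfield $F$ is a hypergroup $(M,+)$ with a map $F\times M\to\mathscr{P}^*(M)$, $(a,x)\mapsto a\cdot x=ax$, such that $a(x+y)=ax+ay$, $(a+b)x=ax+bx$, $(ab)x=a(bx)$ for all $a,b\in F$, $x,y\in M$. Standing assumptions: every hypervector space $M$ has a scalar identity $0_M$ for $+$ (i.e. $0_M+x=x+0_M=\{x\}$), and every hyperfield $F$ has a scalar identity $0_F$ for $+$ and a multiplication unit $1$, such that $0_F x=\{0_M\}$ and $1x=\{x\}$ for all $x\in M$. **Lie hyperalgebras.** A Lie hyperalgebra over a hyperfield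 $F$ is a hypervector space $L$ over $F$ with a map (hyperbracket) $[-,-]:L\times L\to\mathscr{P}^*(L)$ that is bilinear, i.e. $[\lambda_1x_1+\lambda_2x_2,y]=\lambda_1[x_1,y]+\lambda_2[x_2,y]$ and $[x,\lambda_1y_1+\lambda_2y_2]=\lambda_1[x,y_1]+\lambda_2[x,y_2]$, such that $0\in[x,x]$ and $0\in[x,[y,z]]+[y,[z,x]]+[z,[x,y]]$ for all $x,y,z\in L$. Put $[A,B]=\bigcup_{a\in A,b\in B}[a,b]$, $L^{[0]}=L$, and $L^{[i]}=[L^{[i-1]},L^{[i-1]}]$ for $i\ge1$. **Hyperbracket functions.** A hyperbracket function $f(g_1,\dots,g_m)$ is an arbitrary composition of the arguments $g_1,\dots,g_m$ using only the hyperbracket (a bracket monomial, each argument used once; for $m=1$, $f(g)=g$), extended to subsets. **The relation $\mathcal{S}_n$.** $\mathbb{S}_t$ is the symmetric group on $\{1,\dots,t\}$. For $n\in\mathbb{N}$ ($n\ge1$) and $x,y\in L$, $x\,\mathcal{S}_n\,y$ if and only if there exist: $t\in\mathbb{N}$ and $\sigma\in\mathbb{S}_t$; for $1\le i\le t$, $m_i\in\mathbb{N}$, a hyperbracket function $f_i$ of $m_i$ arguments, elements $h_{i1},\dots,h_{im_i}\in L$, and $\sigma_i\in\mathbb{S}_{m_i}$ such that $\sigma_i(j)=j$ whenever $h_{ij}\notin L^{[n-1]}$; for $1\le j\le m_i$, $p_{ij}\in\mathbb{N}$ and $\sigma_{ij}\in\mathbb{S}_{p_{ij}}$; for $1\le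 k\le p_{ij}$, $q_{ijk}\in\mathbb{N}$, $\lambda_{ijk1},\dots,\lambda_{ijkq_{ijk}}\in F$ and $\sigma_{ijk}\in\mathbb{S}_{q_{ijk}}$; such that $$x\in\sum_{i=1}^t\ell_i,\quad \ell_i=f_i(g_{i1},\dots,g_{im_i}),\quad g_{ij}=\Big(\sum_{k=1}^{p_{ij}}\big(\prod_{r=1}^{q_{ijk}}\lambda_{ijkr}\big)\Big)\cdot h_{ij},$$ $$y\in\sum_{i=1}^t\ell'_i,\quad \ell'_i=f_{\sigma(i)}(g'_{i1},\dots,g'_{im_{\sigma(i)}}),\quad g'_{ij}=A_{\sigma(i)\sigma_{\sigma(i)}(j)}\cdot h_{\sigma(i)\sigma_{\sigma(i)}(j)}\ (1\le j\le m_{\sigma(i)}),$$ where $A_{ij}=\sum_{k=1}^{p_{ij}}B_{ij\sigma_{ij}(k)}$ and $B_{ijk}=\prod_{r=1}^{q_{ijk}}\lambda_{ijk\sigma_{ijk}(r)}$. (Sums and products are taken in the indicated order.) $\mathcal{S}_n$ is reflexive and symmetric; $\mathcal{S}_n^*$ is its transitive closure. **The relation $\alpha$.** On a hyperring $R$, $x\,\alpha\,y$ iff there exist $t\in\mathbb{N}$, $\sigma\in\mathbb{S}_t$, $k_1,\dots,k_t\in\mathbb{N}$, $\sigma_i\in\mathbb{S}_{k_i}$ and $x_{i1},\dots,x_{ik_i}\in R$ with $x\in\sum_{i=1}^t\big(\prod_{j=1}^{k_i}x_{ij}\big)$ and $y\in\sum_{i=1}^tA_{\sigma(i)}$, where $A_i=\prod_{j=1}^{k_i}x_{i\sigma_i(j)}$.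 $\alpha^*$ is the transitive closure of $\alpha$; $F/\alpha^*$ is a field with operations induced by those of $F$ (the sum, resp. product, of two classes is the class of any element of the sum, resp. product, of representatives). **Quotient operations.** For an equivalence relation $\rho$ on $L$ and an equivalence relation $\delta$ on $F$ (here $\rho=\mathcal{S}_n^*$, $\delta=\alpha^*$), with classes $\bar x$ and $\widetilde\lambda$, the operations on $L/\rho$ are $\bar x\oplus\bar y=\bar z$ for all $z\in x+y$; $\widetilde\lambda\odot\bar x=\bar z$ for all $z\in\lambda\cdot x$; $\lfloor\bar x,\bar y\rfloor=\bar z$ for all $z\in[x,y]$. **Solvability.** For a Lie algebra $M$, $M^{(0)}=M$ and $M^{(i)}=\lfloor M^{(i-1)},M^{(i-1)}\rfloor$ is the span of brackets of elements of $M^{(i-1)}$. $M$ is solvable of length $m$ if $M^{(m)}=0$ and $M^{(m-1)}\ne0$; ''length at most $n$'' means $M^{(n)}=0$. *)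

(* Defs.v *)
From HB Require Import structures.
From mathcomp Require Import all_boot all_fingroup all_algebra.
From mathcomp Require Import boolp classical_sets.
From Stdlib Require Import Relation_Operators.

Set Implicit Arguments.
Unset Strict Implicit.
Unset Printing Implicit Defensive.

Local Open Scope classical_set_scope.

(** ** Hyperstructures *)

(* A set-valued operation extended to subsets; elements are identified with
   singletons, so [x o B] is written [hlift o [set x] B]. *)
Definition hlift (S T U : Type) (op : S -> T -> set U)
    (A : set S) (B : set T) : set U :=
  \bigcup_(a in A) \bigcup_(b in B) op a b.

(* The ordered composite of [n] subsets. It is [set0] for [n = 0], so that in
   the relations [alpha] and [calS] below every length is in fact positive. *)
Definition hbig (T : Type) (op : T -> T -> set T) (n : nat)
    (A : 'I_n -> set T) : set T :=
  if [seq A i | i <- enum 'I_n] is a :: s then foldl (hlift op) a s else set0.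

Section Hyperoperations.
Variable T : Type.
Implicit Types (op add mul : T -> T -> set T) (H : set T).

Record semihypergroup_on op H : Prop := SemihypergroupOn {
  hop_closed : forall x y, H x -> H y -> op x y `<=` H;
  hop_nonempty : forall x y, H x -> H y -> op x y !=set0;
  hop_assoc : forall x y z, H x -> H y -> H z ->
    hlift op (op x y) [set z] = hlift op [set x] (op y z) }.

Record hypergroup_on op H : Prop := HypergroupOn {
  hypergroup_semi : semihypergroup_on op H;
  hypergroup_reprol : forall x, H x -> hlift op [set x] H = H;
  hypergroup_repror : forall x, H x -> hlift op H [set x] = H }.

Definition semihypergroup op := semihypergroup_on op setT.
Definition hypergroup op := hypergroup_on op setT.

Record hyperring add mul : Prop := Hyperring {
  hyperring_add : hypergroup add;
  hyperring_mul : semihypergroup mul;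
  hyperring_mulDr : forall a b c,
    hlift mul [set a] (add b c) = hlift add (mul a b) (mul a c);
  hyperring_mulDl : forall a b c,
    hlift mul (add a b) [set c] = hlift add (mul a c) (mul b c) }.

Definition scalar_identity op (e : T) : Prop :=
  forall x, op e x = [set x] /\ op x e = [set x].

(* A unit in the sense of hyperstructures: unlike for a scalar identity, the
   products [e o x] and [x o e] only have to contain [x]. *)
Definition hyper_unit op (e : T) : Prop :=
  forall x, op e x x /\ op x e x.

End Hyperoperations.

Record hyperfield := Hyperfield {
  hf_sort :> Type;
  hf_add : hf_sort -> hf_sort -> set hf_sort;
  hf_mul : hf_sort -> hf_sort -> set hf_sort;
  hf_zero : hf_sort;
  hf_one : hf_sort;
  hf_ring : hyperring hf_add hf_mul;
  hf_addP : scalar_identity hf_add hf_zero;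
  hf_mulP : hypergroup_on hf_mul [set~ hf_zero];
  hf_oneP : hyper_unit hf_mul hf_one }.

Record hypervector_space (F : hyperfield) := HypervectorSpace {
  hv_sort :> Type;
  hv_add : hv_sort -> hv_sort -> set hv_sort;
  hv_scale : F -> hv_sort -> set hv_sort;
  hv_zero : hv_sort;
  hv_hypergroup : hypergroup hv_add;
  hv_scale_nonempty : forall a x, hv_scale a x !=set0;
  hv_scaleDr : forall a x y,
    hlift hv_scale [set a] (hv_add x y)
      = hlift hv_add (hv_scale a x) (hv_scale a y);
  hv_scaleDl : forall a b x,
    hlift hv_scale (hf_add a b) [set x]
      = hlift hv_add (hv_scale a x) (hv_scale b x);
  hv_scaleA : forall a b x,
    hlift hv_scale (hf_mul a b) [set x] = hlift hv_scale [set a] (hv_scale b x);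
  hv_addP : scalar_identity hv_add hv_zero;
  hv_scale0 : forall x, hv_scale (hf_zero F) x = [set hv_zero];
  hv_scale1 : forall x, hv_scale (hf_one F) x = [set x] }.

Record lie_hyperalgebra (F : hyperfield) := LieHyperalgebra {
  lh_space :> hypervector_space F;
  lh_br : lh_space -> lh_space -> set lh_space;
  lh_br_nonempty : forall x y, lh_br x y !=set0;
  lh_br_linearl : forall (a b : F) x1 x2 y,
    hlift lh_br (hlift (@hv_add _ _) (hv_scale a x1) (hv_scale b x2)) [set y]
      = hlift (@hv_add _ _) (hlift (@hv_scale _ _) [set a] (lh_br x1 y))
                            (hlift (@hv_scale _ _) [set b] (lh_br x2 y));
  lh_br_linearr : forall (a b : F) x y1 y2,
    hlift lh_br [set x] (hlift (@hv_add _ _) (hv_scale a y1) (hv_scale b y2))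
      = hlift (@hv_add _ _) (hlift (@hv_scale _ _) [set a] (lh_br x y1))
                            (hlift (@hv_scale _ _) [set b] (lh_br x y2));
  lh_br_alt : forall x, lh_br x x (hv_zero lh_space);
  lh_jacobi : forall x y z,
    hlift (@hv_add _ _)
      (hlift (@hv_add _ _) (hlift lh_br [set x] (lh_br y z))
                           (hlift lh_br [set y] (lh_br z x)))
      (hlift lh_br [set z] (lh_br x y)) (hv_zero lh_space) }.

(** ** The relation [alpha] *)

Section Alpha.
Variable F : hyperfield.
Local Notation hsum := (hbig (@hf_add F)).
Local Notation hprod := (hbig (@hf_mul F)).

Definition alpha (x y : F) : Prop :=
  exists (t : nat) (s : 'S_t) (k : 'I_t -> nat) (si : forall i, 'S_(k i))
         (u : forall i, 'I_(k i) -> F),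
    let A i := hprod (fun j => [set u i (si i j)]) in
    hsum (fun i => hprod (fun j => [set u i j])) x /\
    hsum (fun i => A (s i)) y.

Definition alpha_star : F -> F -> Prop := clos_trans F alpha.

End Alpha.

(** ** The relation [S_n] *)

Inductive bracket_monomial (m : nat) : Type :=
| BArg of 'I_m
| BBr of bracket_monomial m & bracket_monomial m.

Fixpoint bargs (m : nat) (f : bracket_monomial m) : seq 'I_m :=
  match f with
  | BArg j => [:: j]
  | BBr f1 f2 => bargs f1 ++ bargs f2
  end.

(* Every argument occurs exactly once (the order is free). *)
Definition bracket_function (m : nat) : Type :=
  {f : bracket_monomial m | perm_eq (bargs f) (enum 'I_m)}.

Section CalS.
Variables (F : hyperfield) (L : lie_hyperalgebra F).
Local Notation hbr := (hlift (@lh_br F L)).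
Local Notation hscale := (hlift (@hv_scale F L)).
Local Notation hsumL := (hbig (@hv_add F L)).
Local Notation hsum := (hbig (@hf_add F)).
Local Notation hprod := (hbig (@hf_mul F)).

Fixpoint beval (m : nat) (f : bracket_monomial m) (g : 'I_m -> set L) : set L :=
  match f with
  | BArg j => g j
  | BBr f1 f2 => hbr (beval f1 g) (beval f2 g)
  end.

Fixpoint hderived (i : nat) : set L :=
  if i is i'.+1 then hbr (hderived i') (hderived i') else setT.

(* [s], [si], [sij], [sijk] are the permutations sigma, sigma_i, sigma_ij,
   sigma_ijk. *)
Definition calS (n : nat) (x y : L) : Prop :=
  exists (t : nat) (s : 'S_t)
         (m : 'I_t -> nat) (f : forall i, bracket_function (m i))
         (h : forall i, 'I_(m i) -> L) (si : forall i, 'S_(m i))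
         (p : forall i, 'I_(m i) -> nat) (sij : forall i j, 'S_(p i j))
         (q : forall i j, 'I_(p i j) -> nat)
         (lam : forall i j k, 'I_(q i j k) -> F)
         (sijk : forall i j k, 'S_(q i j k)),
    let g i j :=
      hscale (hsum (fun k => hprod (fun r => [set lam i j k r])))
             [set h i j] in
    let B i j k := hprod (fun r => [set lam i j k (sijk i j k r)]) in
    let A i j := hsum (fun k => B i j (sij i j k)) in
    let g' i j := hscale (A (s i) (si (s i) j)) [set h (s i) (si (s i) j)] in
    [/\ forall i j, ~ hderived n.-1 (h i j) -> si i j = j,
        hsumL (fun i => beval (sval (f i)) (g i)) x
      & hsumL (fun i => beval (sval (f (s i))) (g' i)) y].

Definition calS_star (n : nat) : L -> L -> Prop := clos_trans L (calS n).

End CalS.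

(** ** Quotients *)

Definition quot (T : Type) (r : T -> T -> Prop) : Type :=
  {A : set T | exists x, A = [set y | r x y]}.

Definition cls (T : Type) (r : T -> T -> Prop) (x : T) : quot r :=
  exist _ [set y | r x y] (ex_intro _ x erefl).

(* As hyperoperations have non-empty values, [qop] is unique if it exists. *)
Definition induced (S T U : Type) (r : S -> S -> Prop) (r' : T -> T -> Prop)
    (r'' : U -> U -> Prop) (op : S -> T -> set U)
    (qop : quot r -> quot r' -> quot r'') : Prop :=
  forall x y z, op x y z -> qop (cls r x) (cls r' y) = cls r'' z.

(** ** Lie algebras *)

Section LieAlgebra.
Local Open Scope ring_scope.
Variables (K : fieldType) (V : lmodType K) (br : V -> V -> V).

Record lie_algebra : Prop := LieAlgebra {
  lie_linearl : forall a b u1 u2 v,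
    br (a *: u1 + b *: u2) v = a *: br u1 v + b *: br u2 v;
  lie_linearr : forall a b u v1 v2,
    br u (a *: v1 + b *: v2) = a *: br u v1 + b *: br u v2;
  lie_alt : forall u, br u u = 0;
  lie_jacobi : forall u v w,
    br u (br v w) + br v (br w u) + br w (br u v) = 0 }.

Definition subspace (W : set V) : Prop :=
  W 0 /\ forall a u v, W u -> W v -> W (a *: u + v).

Definition lspan (A : set V) : set V := smallest subspace A.

Fixpoint lie_derived (i : nat) : set V :=
  if i is i'.+1
  then lspan [set br u v | u in lie_derived i' & v in lie_derived i']
  else setT.

Definition solvable_length_le (n : nat) : Prop := lie_derived n = [set 0].

End LieAlgebra.

(** ** Algebraic structures on the quotients *)

(* [GRing.Field T] and [GRing.Lmodule K T] are the types of field and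
   [K]-module structures with carrier [T]; here the carriers are the sets of
   classes themselves. *)

Notation alpha_quot F := (quot (@alpha_star F)).
Notation calS_quot L n := (quot (@calS_star _ L n)).

Section QuotientStructures.
Variables (F : hyperfield) (cK : GRing.Field (alpha_quot F)).
Local Notation K := (GRing.Field.Pack cK).

Definition quotient_field : Prop :=
  induced (@hf_add F) (@GRing.add K) /\ induced (@hf_mul F) (@GRing.mul K).

Variables (L : lie_hyperalgebra F) (n : nat).
Variable cV : GRing.Lmodule K (calS_quot L n).
Local Notation V := (GRing.Lmodule.Pack cV).

Definition quotient_operations
    (br : calS_quot L n -> calS_quot L n -> calS_quot L n) : Prop :=
  [/\ induced (@hv_add F L) (@GRing.add V),
      induced (@hv_scale F L) (@GRing.scale K V)
    & induced (@lh_br F L) br].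

End QuotientStructures.

(* Main.v *)
Require Import Defs.
From HB Require Import structures.
From mathcomp Require Import all_boot all_fingroup all_algebra.
From mathcomp Require Import boolp classical_sets.
From Stdlib Require Import Relation_Operators.

(** Distributivity, bilinearity and the module axioms are exact identities
    between non-empty subsets of [F] and [L], so they pass to classes as soon as
    the operations on classes are defined.  What remains is that [calS_star] is
    an equivalence relation compatible with the three hyperoperations, and that
    it identifies enough elements.

    Compatibility is proved through a description of [calS] by pairs of subsets.
    Two subsets are [rearranged] when they lie in two composites whose factors
    are related one by one, up to a permutation of the factors.  Iterating this
    gives products of scalars, sums of products ([coef_pair]), monomials with
    permuted leaves ([mono_pair]) and sums of monomials ([sum_pair]), and
    [calSP] says that [calS] is [sum_pair] on singletons.  In this form the
    closure properties are short: a sum receives one more term, while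
    multiplication by a scalar and bracketing with an element are additive maps
    ([rearranged_himage]) that send a monomial to a monomial.  For the scalar,
    bilinearity moves it into the coefficient of one chosen leaf, at the two
    positions of that leaf; for the bracket, one leaf that the permutation
    fixes is added.

    Three identifications are used.  Permuting a sum of two terms makes the addition
    commutative ([sum_pair_addC]).  A pair of [alpha]-related scalars is a
    [coef_pair], so the scalar multiplication is well defined on
    [F / alpha_star] ([sum_pair_alpha]).  Exchanging two leaves in
    [hderived n.-1] gives [a, b] = [b, a] for the classes of [a] and [b]
    ([mono_pair_swap]).

    The last one gives solvability.  The derived subspace of index [n - 1] is
    contained in the span of the classes of elements of [hderived n.-1]
    ([lie_derived_sub]).  For two such classes the bracket is both symmetric and skew-symmetric, hence
    twice it is zero, and it vanishes because the characteristic is not 2.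
    Bilinearity extends this to the span. *)

Set Implicit Arguments.
Unset Strict Implicit.
Unset Printing Implicit Defensive.

Import GRing.Theory.

Local Open Scope classical_set_scope.

Lemma dependent_choice (A : Type) (B : A -> Type) (R : forall a, B a -> Prop) :
  (forall a, exists b, R a b) -> exists f : forall a, B a, forall a, R a (f a).
Proof.
by move=> H; exists (fun a => sval (cid (H a))) => a; case: (cid (H a)).
Qed.

(** * Ordered composites of subsets *)

Lemma hlift_sub (S T U : Type) (op : S -> T -> set U) (A A' : set S)
    (B B' : set T) :
  A `<=` A' -> B `<=` B' -> hlift op A B `<=` hlift op A' B'.
Proof.
move=> sA sB z [a Aa [b Bb abz]].
by exists a; [exact: sA | exists b; [exact: sB |]].
Qed.

Lemma hlift11 (S T U : Type) (op : S -> T -> set U) a b :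
  hlift op [set a] [set b] = op a b.
Proof. by rewrite /hlift !bigcup_set1. Qed.

Lemma hbig0 (T : Type) (op : T -> T -> set T) (A : 'I_0 -> set T) :
  hbig op A = set0.
Proof. by rewrite /hbig; case: (enum 'I_0) (size_enum_ord 0). Qed.

Section Composites.
Variables (T : Type) (op : T -> T -> set T).
Hypothesis opA : semihypergroup op.

Lemma hliftA : associative (hlift op).
Proof.
move=> A B C; apply/seteqP; split=> z.
  case=> a Aa [w [b Bb [c Cc bcw]] awz].
  have: hlift op [set a] (op b c) z by exists a => //; exists w.
  rewrite -(hop_assoc opA) // => -[v abv [_ -> vcz]].
  by exists v; [exists a => //; exists b | exists c].
case=> w [a Aa [b Bb abw]] [c Cc wcz].
have: hlift op (op a b) [set c] z by exists w => //; exists c.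
rewrite (hop_assoc opA) // => -[_ -> [v bcv avz]].
by exists a => //; exists v => //; exists b => //; exists c.
Qed.

Lemma hbig1 (A : 'I_1 -> set T) : hbig op A = A ord0.
Proof.
rewrite /hbig enum_ordSl /= -map_comp.
by case: (enum 'I_0) (size_enum_ord 0).
Qed.

Lemma hbigS n (A : 'I_n.+2 -> set T) :
  hbig op A = hlift op (A ord0) (hbig op (fun i => A (lift ord0 i))).
Proof.
rewrite /hbig !enum_ordSl /= -!map_comp /=.
set s := map _ _; set a := A ord0; set b := A _.
by elim: s b => //= c s IHs b; rewrite -hliftA IHs.
Qed.

Lemma hbig_sub n (A B : 'I_n -> set T) :
  (forall i, A i `<=` B i) -> hbig op A `<=` hbig op B.
Proof.
case: n A B => [|n] A B sAB; first by rewrite !hbig0.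
elim: n A B sAB => [|n IHn] A B sAB; first by rewrite !hbig1; exact: sAB.
by rewrite !hbigS; apply: hlift_sub => //; apply: IHn => i.
Qed.

End Composites.

Definition himage (T U : Type) (phi : T -> set U) (A : set T) : set U :=
  \bigcup_(a in A) phi a.

(** A map that distributes over a hyperoperation only up to inclusion still
    carries a composite into the composite of the images.  Inclusion is all that
    is available once the arguments are subsets, as each occurrence of a subset
    is expanded with its own choice of element. *)
Lemma himage_hbig (T U : Type) (opT : T -> T -> set T) (opU : U -> U -> set U)
    (phi : T -> set U) n (A : 'I_n -> set T) :
  semihypergroup opT -> semihypergroup opU ->
  (forall a b, himage phi (opT a b) `<=` hlift opU (phi a) (phi b)) ->
  himage phi (hbig opT A) `<=` hbig opU (fun i => himage phi (A i)).
Proof.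
move=> TA UA phiM; case: n A => [|n] A; first by rewrite !hbig0 => z [].
elim: n A => [|n IHn] A; first by rewrite !hbig1.
rewrite !hbigS // => z [w [a Aa [b Ab abw]] wz].
have [|u au [v bv uvz]] := phiM a b z; first by exists w.
exists u; first by exists a.
by exists v => //; apply: IHn; exists b.
Qed.

(** * Rearranged composites *)

Section Rearranged.
Variables (T : Type) (op : T -> T -> set T).
Implicit Types (R : set T -> set T -> Prop) (X : set T).

(** Inclusions, rather than equalities, keep this relation stable under maps
    that distribute only up to inclusion. *)
Definition rearranged R X X' : Prop :=
  exists n (A A' : 'I_n -> set T) (s : 'S_n),
    [/\ forall i, R (A i) (A' i), X `<=` hbig op A
      & X' `<=` hbig op (fun i => A' (s i))].

(** The relation on factors at the lowest level: on singletons it is equality,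
    and like [rearranged] it passes to smaller subsets. *)
Definition same_point X X' : Prop :=
  exists u, X `<=` [set u] /\ X' `<=` [set u].

Lemma same_point_refl u : same_point [set u] [set u].
Proof. by exists u; split. Qed.

Lemma rearranged_sub R X Y X' Y' : X `<=` Y -> X' `<=` Y' ->
  rearranged R Y Y' -> rearranged R X X'.
Proof.
move=> sXY sXY' [n [A [A' [s [RA YA YA']]]]].
by exists n, A, A', s; split=> //; apply: subset_trans; eassumption.
Qed.

Lemma rearranged_base R X X' : R X X' -> rearranged R X X'.
Proof.
by move=> RX; exists 1, (fun=> X), (fun=> X'), 1%g; split=> //; rewrite hbig1.
Qed.

Lemma rearranged_sym R :
  (forall X X', R X X' -> R X' X) ->
  forall X X', rearranged R X X' -> rearranged R X' X.
Proof.
move=> Rsym X X' [n [A [A' [s [RA XA XA']]]]].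
exists n, (fun i => A' (s i)), (fun i => A (s i)), s^-1%g; split=> // [i|].
  exact: Rsym.
by under [fun i => _]funext => i do rewrite permKV.
Qed.

Hypothesis opA : semihypergroup op.

(** The new factor comes first and the lifted permutation fixes it.  If there
    is no other factor, both composites are empty and remain so. *)
Lemma rearranged_cons R X0 X0' X X' :
  R X0 X0' -> rearranged R X X' ->
  rearranged R (hlift op X0 X) (hlift op X0' X').
Proof.
move=> R0 [[|n] [A [A' [s [RA XA XA']]]]].
  move: XA XA'; rewrite !hbig0 => XA XA'.
  by exists 0, A, A', s; split=> //; rewrite hbig0 => z [a _ [b]];
    [move/XA | move/XA'].
pose ext (u : 'I_n.+1 -> set T) u0 i :=
  if unlift ord0 i is Some j then u j else u0.
exists n.+2, (ext A X0), (ext A' X0'), (lift_perm ord0 ord0 s); split=> [i||].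
- by rewrite /ext; case: unliftP.
- rewrite hbigS // /ext unlift_none.
  apply: hlift_sub => //; apply: subset_trans XA _.
  by apply: hbig_sub => // i; rewrite liftK.
rewrite hbigS // /ext lift_perm_id unlift_none.
apply: hlift_sub => //; apply: subset_trans XA' _.
by apply: hbig_sub => // i; rewrite lift_perm_lift liftK.
Qed.

Lemma rearranged_swap R X Y : R X X -> R Y Y ->
  rearranged R (hlift op X Y) (hlift op Y X).
Proof.
move=> RX RY; pose A (i : 'I_2) := if i == ord0 then X else Y.
exists 2, A, A, (tperm ord0 ord_max); split=> [i||].
- by rewrite /A; case: ifP.
- by rewrite hbigS // hbig1.
rewrite hbigS // hbig1 (_ : lift _ _ = ord_max) ?tpermL ?tpermR //.
exact: val_inj.
Qed.

End Rearranged.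

Lemma rearranged_himage (T U : Type) (opT : T -> T -> set T)
    (opU : U -> U -> set U) (phi : T -> set U)
    (RT : set T -> set T -> Prop) (RU : set U -> set U -> Prop) X X' :
  semihypergroup opT -> semihypergroup opU ->
  (forall a b, himage phi (opT a b) `<=` hlift opU (phi a) (phi b)) ->
  (forall A A', RT A A' -> RU (himage phi A) (himage phi A')) ->
  rearranged opT RT X X' ->
  rearranged opU RU (himage phi X) (himage phi X').
Proof.
move=> TA UA phiM phiR [n [A [A' [s [RA XA XA']]]]].
exists n, (fun i => himage phi (A i)), (fun i => himage phi (A' i)), s.
split=> [i||]; first exact: phiR.
  apply: subset_trans (himage_hbig TA UA phiM).
  by move=> z [a /XA Aa az]; exists a.
apply: subset_trans (himage_hbig TA UA phiM).
by move=> z [a /XA' Aa az]; exists a.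
Qed.

(** * The relation S_n as a rearrangement of sums of monomials *)

Lemma hlift_himage (S T U : Type) (op : S -> T -> set U) a (B : set T) :
  hlift op [set a] B = himage (op a) B.
Proof. by rewrite /hlift bigcup_set1. Qed.

Section Coefficients.
Variable F : hyperfield.
Local Notation add := (@hf_add F).
Local Notation mul := (@hf_mul F).

(** The two coefficients of one leaf in the definition of [calS]; on
    singletons this is [alpha]. *)
Definition coef_pair : set F -> set F -> Prop :=
  rearranged add (rearranged mul (@same_point F)).

Lemma hf_add_semi : semihypergroup add.
Proof. exact: hypergroup_semi (hyperring_add (hf_ring F)). Qed.

Lemma hf_mul_semi : semihypergroup mul.
Proof. exact: hyperring_mul (hf_ring F). Qed.

(** The factors of a product of scalars may be replaced by the points that
    contain them. *)
Lemma rearranged_prodP (P P' : set F) :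
  rearranged mul (@same_point F) P P' <->
  exists q (u : 'I_q -> F) (s : 'S_q),
    P `<=` hbig mul (fun r => [set u r]) /\
    P' `<=` hbig mul (fun r => [set u (s r)]).
Proof.
split=> [[q [A [A' [s [RA PA PA']]]]]|[q [u [s [PA PA']]]]].
  have [u Au] := choice RA; exists q, u, s; split.
    apply: subset_trans PA _; apply: (hbig_sub hf_mul_semi) => r.
    by case: (Au r).
  apply: subset_trans PA' _; apply: (hbig_sub hf_mul_semi) => r.
  by case: (Au (s r)).
exists q, (fun r => [set u r]), (fun r => [set u r]), s.
by split=> // r; exact: same_point_refl.
Qed.

Definition coef_sum p (q : 'I_p -> nat) (u : forall k, 'I_(q k) -> F) : set F :=
  hbig add (fun k => hbig mul (fun r => [set u k r])).

Lemma coef_pairP (C C' : set F) :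
  coef_pair C C' <->
  exists p (s : 'S_p) (q : 'I_p -> nat) (u : forall k, 'I_(q k) -> F)
         (t : forall k, 'S_(q k)),
    C `<=` coef_sum u /\ C' `<=` coef_sum (fun k r => u (s k) (t (s k) r)).
Proof.
split=> [[p [A [A' [s [RA CA CA']]]]]|[p [s [q [u [t [CA CA']]]]]]].
  have [q RAq] := dependent_choice (fun k => (rearranged_prodP _ _).1 (RA k)).
  have [u RAu] := dependent_choice RAq.
  have [t RAt] := dependent_choice RAu.
  exists p, s, q, u, t; split.
    apply: subset_trans CA _; apply: (hbig_sub hf_add_semi) => k.
    by case: (RAt k).
  apply: subset_trans CA' _; apply: (hbig_sub hf_add_semi) => k.
  by case: (RAt (s k)).
exists p, (fun k => hbig mul (fun r => [set u k r])),
  (fun k => hbig mul (fun r => [set u k (t k r)])), s.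
by split=> // k; apply/rearranged_prodP; exists (q k), (u k), (t k); split.
Qed.

Lemma alphaP (a b : F) : alpha a b <-> coef_pair [set a] [set b].
Proof.
split=> [[t [s [k [si [u [ab ab']]]]]]|].
  by apply/coef_pairP; exists t, s, k, u, si; split=> _ ->.
move=> /coef_pairP[t [s [k [u [si [ab ab']]]]]].
by exists t, s, k, si, u; split; [apply: ab | apply: ab'].
Qed.

Lemma coef_pair_sym C C' : coef_pair C C' -> coef_pair C' C.
Proof.
apply: rearranged_sym => {C C'}; apply: rearranged_sym => X X' [u [Xu X'u]].
by exists u.
Qed.

Lemma coef_pair1 a : coef_pair [set a] [set a].
Proof. by do 2!apply: rearranged_base; exact: same_point_refl. Qed.

Lemma alpha_refl (a : F) : alpha a a.
Proof. exact/alphaP/coef_pair1. Qed.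

(** Distributivity puts the scalar in front of each product of the sum, where
    it becomes one more factor that the permutation fixes. *)
Lemma coef_pair_mul a C C' :
  coef_pair C C' -> coef_pair (himage (mul a) C) (himage (mul a) C').
Proof.
apply: (rearranged_himage hf_add_semi hf_add_semi) => [b c|A A'].
  by rewrite -hlift_himage (hyperring_mulDr (hf_ring F)).
rewrite -!hlift_himage; apply: (rearranged_cons hf_mul_semi) => //.
exact: same_point_refl.
Qed.

End Coefficients.

Section HyperbracketIdentities.
Variables (F : hyperfield) (L : lie_hyperalgebra F).
Local Notation add := (@hv_add F L).
Local Notation scale := (@hv_scale F L).
Local Notation br := (@lh_br F L).
Local Notation hadd := (hlift add).

Lemma hv_add_semi : semihypergroup add.
Proof. exact: hypergroup_semi (hv_hypergroup L). Qed.

Lemma hadd0 A : hadd A [set hv_zero L] = A.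
Proof.
apply/seteqP; split=> [z [a Aa [_ ->]]|a Aa].
  by rewrite (hv_addP a).2 => ->.
by exists a => //; exists (hv_zero L) => //; rewrite (hv_addP a).2.
Qed.

Lemma hscale1 A : hlift scale [set hf_one F] A = A.
Proof.
apply/seteqP; split=> [z [_ -> [a Aa]]|a Aa]; first by rewrite hv_scale1 => ->.
by exists (hf_one F) => //; exists a => //; rewrite hv_scale1.
Qed.

Lemma hscale0 A : A !=set0 -> hlift scale [set hf_zero F] A = [set hv_zero L].
Proof.
move=> [a Aa]; apply/seteqP; split=> [z [_ -> [b _]]|_ ->].
  by rewrite hv_scale0.
by exists (hf_zero F) => //; exists a => //; rewrite hv_scale0.
Qed.

(** Additivity is bilinearity with both scalars equal to the unit, which acts
    on [L] as the identity. *)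
Lemma br_addl x1 x2 y : hlift br (add x1 x2) [set y] = hadd (br x1 y) (br x2 y).
Proof.
have := lh_br_linearl (hf_one F) (hf_one F) x1 x2 y.
by rewrite !hscale1 !hv_scale1 hlift11.
Qed.

Lemma br_addr x y1 y2 : hlift br [set x] (add y1 y2) = hadd (br x y1) (br x y2).
Proof.
have := lh_br_linearr (hf_one F) (hf_one F) x y1 y2.
by rewrite !hscale1 !hv_scale1 hlift11.
Qed.

(** Homogeneity is bilinearity with second scalar zero: the second summand
    then collapses to the scalar identity of the addition. *)
Lemma br_scalel a x y :
  hlift br (scale a x) [set y] = hlift scale [set a] (br x y).
Proof.
have := lh_br_linearl a (hf_zero F) x x y.
by rewrite hscale0 ?hv_scale0 ?hadd0 //; apply: lh_br_nonempty.
Qed.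

Lemma br_scaler a x y :
  hlift br [set x] (scale a y) = hlift scale [set a] (br x y).
Proof.
have := lh_br_linearr a (hf_zero F) x y y.
by rewrite hscale0 ?hv_scale0 ?hadd0 //; apply: lh_br_nonempty.
Qed.

Lemma hscaleA a (C : set F) h :
  himage (scale a) (hlift scale C [set h])
    = hlift scale (himage (@hf_mul F a) C) [set h].
Proof.
apply/seteqP; split=> z.
  move=> [w [c Cc [_ -> chw]] awz].
  have: hlift scale [set a] (scale c h) z by exists a => //; exists w.
  rewrite -hv_scaleA => -[b acb [_ -> bhz]].
  by exists b; [exists c | exists h].
move=> [b [c Cc acb] [_ -> bhz]].
have: hlift scale (@hf_mul F a c) [set h] z by exists b => //; exists h.
rewrite hv_scaleA => -[_ -> [w chw awz]].
by exists w => //; exists c => //; exists h.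
Qed.

(** ** Hyperbracket functions *)

Lemma beval_sub m (f : bracket_monomial m) (g g' : 'I_m -> set L) :
  (forall j, g j `<=` g' j) -> beval f g `<=` beval f g'.
Proof. by move=> sgg'; elim: f => //= f1 IH1 f2 IH2; apply: hlift_sub. Qed.

Lemma eq_in_beval m (f : bracket_monomial m) (g g' : 'I_m -> set L) :
  {in bargs f, forall j, g j = g' j} -> beval f g = beval f g'.
Proof.
elim: f => /= [j|f1 IH1 f2 IH2] eg; first by apply: eg; rewrite inE.
by rewrite IH1 ?IH2 // => j jf; apply: eg; rewrite mem_cat jf ?orbT.
Qed.

Fixpoint brename m m' (r : 'I_m -> 'I_m') (f : bracket_monomial m) :
    bracket_monomial m' :=
  match f with
  | BArg j => BArg (r j)
  | BBr f1 f2 => BBr (brename r f1) (brename r f2)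
  end.

Lemma bargs_brename m m' (r : 'I_m -> 'I_m') f :
  bargs (brename r f) = map r (bargs f).
Proof. by elim: f => //= f1 -> f2 ->; rewrite map_cat. Qed.

Lemma beval_brename m m' (r : 'I_m -> 'I_m') f (g : 'I_m' -> set L) :
  beval (brename r f) g = beval f (fun j => g (r j)).
Proof. by elim: f => //= f1 -> f2 ->. Qed.

Lemma count_bargs m (f : bracket_function m) j :
  count_mem j (bargs (sval f)) = 1.
Proof.
by rewrite (elimT seq.permP (svalP f)) count_uniq_mem ?enum_uniq // mem_enum.
Qed.

(** A scalar in front of a monomial can be moved to any leaf, by descending
    towards the branch that contains it.  The leaf has to occur exactly once,
    otherwise the scalar would act several times. *)
Lemma beval_scale a m (f : bracket_monomial m) j0 (g : 'I_m -> set L) :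
  count_mem j0 (bargs f) = 1 ->
  himage (scale a) (beval f g) `<=`
    beval f (fun j => if j == j0 then himage (scale a) (g j) else g j).
Proof.
set g' := fun j => _.
have g'E f' : count_mem j0 (bargs f') = 0 -> beval f' g = beval f' g'.
  move=> /eqP; rewrite -leqn0 leqNgt -has_count has_pred1 => nj0.
  by apply: eq_in_beval => j jf; rewrite /g' (negPf (memPn nj0 _ jf)).
elim: f => /= [j|f1 IH1 f2 IH2].
  by rewrite /g' addn0; case: (j == j0) => // _ z.
rewrite count_cat => j0f z [w [x f1x [y f2y xyw]] awz].
have axy : hlift scale [set a] (br x y) z by exists a => //; exists w.
have [[c1 /g'E <-]|[/g'E <- c2]] :
    count_mem j0 (bargs f1) = 1 /\ count_mem j0 (bargs f2) = 0 \/
    count_mem j0 (bargs f1) = 0 /\ count_mem j0 (bargs f2) = 1.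
- by case: (count _ _) j0f => [|[|k]]; case: (count _ _) => [|[|l]] //; auto.
- move: axy; rewrite -br_scalel => -[x' axx' [_ -> x'yz]].
  by exists x'; [apply: IH1 c1 _ _; exists x | exists y].
- move: axy; rewrite -br_scaler => -[_ -> [y' ayy' xy'z]].
  by exists x => //; exists y' => //; apply: IH2 c2 _ _; exists y.
Qed.

End HyperbracketIdentities.

Section Monomials.
Variables (F : hyperfield) (L : lie_hyperalgebra F) (D : set L).
Local Notation add := (@hv_add F L).
Local Notation scale := (@hv_scale F L).
Local Notation br := (@lh_br F L).

(** [D] is the set whose elements may change leaves; it is [hderived n.-1] in
    the relation [calS n]. *)
Definition mono_pair (X X' : set L) : Prop :=
  exists m (f : bracket_function m) (C C' : 'I_m -> set F) (h : 'I_m -> L)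
         (s : 'S_m),
    [/\ forall j, coef_pair (C j) (C' j),
        forall j, ~ D (h j) -> s j = j,
        X `<=` beval (sval f) (fun j => hlift scale (C j) [set h j])
      & X' `<=` beval (sval f) (fun j => hlift scale (C' (s j)) [set h (s j)])].

Lemma mono_pair_sym X X' : mono_pair X X' -> mono_pair X' X.
Proof.
move=> [m [f [C [C' [h [s [CC' sD XC X'C']]]]]]].
exists m, f, (fun j => C' (s j)), (fun j => C (s j)), (fun j => h (s j)), s^-1%g.
split=> // [j|j nDh|].
- exact: coef_pair_sym.
- by rewrite -{1}(perm_inj (sD _ nDh)) permK.
apply: subset_trans XC _; apply: beval_sub => j.
by rewrite permKV.
Qed.

Definition one_argument : bracket_function 1.
Proof.
exists (BArg ord0); rewrite enum_ordSl /=.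
by case: (enum 'I_0) (size_enum_ord 0).
Defined.

Lemma mono_pair_scale1 C C' h : coef_pair C C' ->
  mono_pair (hlift scale C [set h]) (hlift scale C' [set h]).
Proof.
move=> CC'; exists 1, one_argument, (fun=> C), (fun=> C'), (fun=> h), 1%g.
by split=> // j; rewrite perm1.
Qed.

Lemma mono_pair_refl x : mono_pair [set x] [set x].
Proof. by rewrite -(hscale1 [set x]); apply/mono_pair_scale1/coef_pair1. Qed.

Definition two_arguments : bracket_function 2.
Proof.
exists (BBr (BArg ord0) (BArg (lift ord0 ord0))).
by rewrite !enum_ordSl /=; case: (enum 'I_0) (size_enum_ord 0).
Defined.

(** The identification responsible for solvability. *)
Lemma mono_pair_swap a b : D a -> D b -> mono_pair (br a b) (br b a).
Proof.
move=> Da Db; pose h (j : 'I_2) := if j == ord0 then a else b.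
exists 2, two_arguments, (fun=> [set hf_one F]), (fun=> [set hf_one F]), h.
exists (tperm ord0 (lift ord0 ord0)); split=> [j|j||].
- exact: coef_pair1.
- by rewrite /h; case: ifP.
- by rewrite /= !hscale1 hlift11.
by rewrite /= !hscale1 tpermL tpermR hlift11.
Qed.

(** The scalar goes to an arbitrary leaf [j0] on one side.  On the other side
    the element of [j0] sits at the leaf that the permutation sends to [j0], and
    the scalar has to follow it there. *)
Lemma mono_pair_scale a X X' :
  mono_pair X X' -> mono_pair (himage (scale a) X) (himage (scale a) X').
Proof.
move=> [m [f [C [C' [h [s [CC' sD XC X'C']]]]]]].
have [j0 _] : exists j0, j0 \in bargs (sval f).
  (* Any leaf will do: the choice is the leftmost one. *)
  by elim: (sval f) => [j|f1 [j j1] f2 _]; exists j;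
    rewrite ?inE //= mem_cat j1.
pose mulat (c : 'I_m -> set F) j :=
  if j == j0 then himage (@hf_mul F a) (c j) else c j.
exists m, f, (mulat C), (mulat C'), h, s; split=> // [j||].
- by rewrite /mulat; case: ifP => // _; apply: coef_pair_mul.
- move=> z [x /XC fx axz].
  have := beval_scale (count_bargs f j0) (ex_intro2 _ _ x fx axz).
  by apply: beval_sub => j; rewrite /mulat; case: ifP => _ y; rewrite ?hscaleA.
move=> z [x /X'C' fx axz].
have := beval_scale (count_bargs f ((s^-1)%g j0)) (ex_intro2 _ _ x fx axz).
apply: beval_sub => j; rewrite /mulat.
by rewrite (canF_eq (permK s)); case: ifP => _ y; rewrite ?hscaleA.
Qed.

Definition add_right_argument m (f : bracket_function m) :
  bracket_function m.+1.
Proof.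
exists (BBr (brename (lift ord0) (sval f)) (BArg ord0)).
by rewrite /= bargs_brename enum_ordSl perm_catC perm_cons perm_map ?(svalP f).
Defined.

Definition add_left_argument m (f : bracket_function m) :
  bracket_function m.+1.
Proof.
exists (BBr (BArg ord0) (brename (lift ord0) (sval f))).
by rewrite /= bargs_brename enum_ordSl perm_cons perm_map ?(svalP f).
Defined.

(** The new leaf holds [w] with coefficient the unit.  The permutation fixes
    it, so nothing has to be assumed about [w]. *)
Lemma mono_pair_br X X' w : mono_pair X X' ->
  mono_pair (himage (br^~ w) X) (himage (br^~ w) X') /\
  mono_pair (himage (br w) X) (himage (br w) X').
Proof.
move=> [m [f [C [C' [h [s [CC' sD XC X'C']]]]]]].
pose ext T (u : 'I_m -> T) u0 (i : 'I_m.+1) :=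
  if unlift ord0 i is Some j then u j else u0.
pose E c k := fun i => hlift scale (ext _ c [set hf_one F] i) [set ext _ k w i].
have E0 c k : E c k ord0 = [set w].
  by rewrite /E /ext unlift_none hscale1.
have ES c k j : E c k (lift ord0 j) = hlift scale (c j) [set k j].
  by rewrite /E /ext liftK.
pose s' := lift_perm ord0 ord0 s.
have Es i : hlift scale (ext _ C' [set hf_one F] (s' i)) [set ext _ h w (s' i)]
    = E (fun j => C' (s j)) (fun j => h (s j)) i.
  rewrite /E /ext; case: (unliftP ord0 i) => [j|] ->.
    by rewrite lift_perm_lift liftK.
  by rewrite lift_perm_id unlift_none.
have CCe j : coef_pair (ext _ C [set hf_one F] j) (ext _ C' [set hf_one F] j).
  by rewrite /ext; case: unliftP => // _; apply: coef_pair1.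
have sDe j : ~ D (ext _ h w j) -> s' j = j.
  rewrite /ext; case: unliftP => [k|] -> nD; last exact: lift_perm_id.
  by rewrite lift_perm_lift sD.
have val_br c k g : (forall i, g i = E c k i) ->
    forall Z, Z `<=` beval (sval f) (fun j => hlift scale (c j) [set k j]) ->
    himage (br^~ w) Z `<=` beval (sval (add_right_argument f)) g /\
    himage (br w) Z `<=` beval (sval (add_left_argument f)) g.
  move=> /funext -> Z Zf; rewrite /= !beval_brename !E0.
  under [fun j => E _ _ _]funext => j do rewrite ES.
  by split=> z [x /Zf fx xz]; [exists x => //; exists w | exists w => //; exists x].
split; [exists m.+1, (add_right_argument f) | exists m.+1, (add_left_argument f)];
  exists (ext _ C [set hf_one F]), (ext _ C' [set hf_one F]), (ext _ h w), s'.
all: by split=> //; [case: (val_br _ _ _ (fun=> erefl) _ XC)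
                    | case: (val_br _ _ _ Es _ X'C')].
Qed.

Definition sum_pair : set L -> set L -> Prop := rearranged add mono_pair.

Lemma sum_pair_refl x : sum_pair [set x] [set x].
Proof. by apply: rearranged_base; apply: mono_pair_refl. Qed.

Lemma sum_pair_sym X X' : sum_pair X X' -> sum_pair X' X.
Proof. by apply: rearranged_sym; apply: mono_pair_sym. Qed.

Lemma sum_pair_addC x y : sum_pair (add x y) (add y x).
Proof.
by rewrite -!(hlift11 add); apply: (rearranged_swap (@hv_add_semi F L));
  apply: mono_pair_refl.
Qed.

Lemma sum_pair_addl w X X' :
  sum_pair X X' -> sum_pair (himage (add w) X) (himage (add w) X').
Proof.
rewrite -!hlift_himage; apply: (rearranged_cons (@hv_add_semi F L)).
exact: mono_pair_refl.
Qed.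

Lemma sum_pair_scale a X X' :
  sum_pair X X' -> sum_pair (himage (scale a) X) (himage (scale a) X').
Proof.
apply: (rearranged_himage (@hv_add_semi F L) (@hv_add_semi F L)) => [x y|].
  by rewrite -hlift_himage hv_scaleDr.
exact: mono_pair_scale.
Qed.

Lemma himage_brl w X : himage (br^~ w) X = hlift br X [set w].
Proof. by rewrite /hlift; under eq_bigcupr do rewrite bigcup_set1. Qed.

Lemma sum_pair_brl w X X' :
  sum_pair X X' -> sum_pair (himage (br^~ w) X) (himage (br^~ w) X').
Proof.
apply: (rearranged_himage (@hv_add_semi F L) (@hv_add_semi F L)) => [x y|A A'].
  by rewrite himage_brl br_addl.
by case/(mono_pair_br w).
Qed.

Lemma sum_pair_brr w X X' :
  sum_pair X X' -> sum_pair (himage (br w) X) (himage (br w) X').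
Proof.
apply: (rearranged_himage (@hv_add_semi F L) (@hv_add_semi F L)) => [x y|A A'].
  by rewrite -hlift_himage br_addr.
by case/(mono_pair_br w).
Qed.

Lemma sum_pair_alpha (a b : F) x : alpha a b -> sum_pair (scale a x) (scale b x).
Proof.
by move/alphaP/(mono_pair_scale1 x); rewrite !hlift11; apply: rearranged_base.
Qed.

End Monomials.

(** Passage from existence for every leaf to families of data indexed by the
    leaves, which is the form used in [calS]. *)
Lemma mono_pairP (F : hyperfield) (L : lie_hyperalgebra F) D (X X' : set L) :
  mono_pair D X X' <->
  exists m (f : bracket_function m) (h : 'I_m -> L) (s : 'S_m)
         (p : 'I_m -> nat) (t : forall j, 'S_(p j))
         (q : forall j, 'I_(p j) -> nat) (u : forall j k, 'I_(q j k) -> F)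
         (v : forall j k, 'S_(q j k)),
    [/\ forall j, ~ D (h j) -> s j = j,
        X `<=` beval (sval f)
          (fun j => hlift (@hv_scale F L) (coef_sum (u j)) [set h j])
      & X' `<=` beval (sval f)
          (fun j => hlift (@hv_scale F L)
             (coef_sum (fun k r => u (s j) (t (s j) k) (v (s j) (t (s j) k) r)))
             [set h (s j)])].
Proof.
split=> [[m [f [C [C' [h [s [CC' sD XC X'C']]]]]]]|].
  have [p CCp] := dependent_choice (fun j => (coef_pairP _ _).1 (CC' j)).
  have [t CCt] := dependent_choice CCp.
  have [q CCq] := dependent_choice CCt.
  have [u CCu] := dependent_choice CCq.
  have [v CCv] := dependent_choice CCu.
  exists m, f, h, s, p, t, q, u, v; split=> //.
    apply: subset_trans XC _; apply: beval_sub => j.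
    by apply: hlift_sub => //; case: (CCv j).
  apply: subset_trans X'C' _; apply: beval_sub => j.
  by apply: hlift_sub => //; case: (CCv (s j)).
move=> [m [f [h [s [p [t [q [u [v [sD XC X'C']]]]]]]]]].
exists m, f, (fun j => coef_sum (u j)),
  (fun j => coef_sum (fun k r => u j (t j k) (v j (t j k) r))), h, s.
split=> // j.
by apply/coef_pairP; exists (p j), (t j), (q j), (u j), (v j); split.
Qed.

(** This equivalence turns the compatibility of [calS] with the
    hyperoperations into properties of [rearranged]. *)
Lemma calSP (F : hyperfield) (L : lie_hyperalgebra F) n (x y : L) :
  calS n x y <-> sum_pair (hderived (n.-1)) [set x] [set y].
Proof.
split.
  move=> [t [s [m [f [h [si [p [sij [q [lam [sijk [sD xs ys]]]]]]]]]]]].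
  exists t, (fun i => beval (sval (f i))
    (fun j => hlift (@hv_scale F L) (coef_sum (lam i j)) [set h i j])).
  exists (fun i => beval (sval (f i)) (fun j => hlift (@hv_scale F L)
    (coef_sum (fun k r => lam i (si i j) (sij i (si i j) k)
       (sijk i (si i j) (sij i (si i j) k) r)))
    [set h i (si i j)])), s.
  split=> [i|_ ->|_ ->] //; apply/mono_pairP.
  exists (m i), (f i), (h i), (si i), (p i), (sij i), (q i), (lam i), (sijk i).
  by split=> //; exact: sD.
move=> [t [X [X' [s [XX' xX yX']]]]].
have [m H] := dependent_choice (fun i => (mono_pairP _ _ _).1 (XX' i)).
have [f {}H] := dependent_choice H.
have [h {}H] := dependent_choice H.
have [si {}H] := dependent_choice H.
have [p {}H] := dependent_choice H.
have [sij {}H] := dependent_choice H.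
have [q {}H] := dependent_choice H.
have [lam {}H] := dependent_choice H.
have [sijk {}H] := dependent_choice H.
exists t, s, m, f, h, si, p, sij, q, lam, sijk; split.
- by move=> i; case: (H i).
- by apply: hbig_sub (xX x erefl); [exact: hv_add_semi | move=> i; case: (H i)].
- by apply: hbig_sub (yX' y erefl); [exact: hv_add_semi | move=> i; case: (H (s i))].
Qed.

(** * Quotients of hyperoperations *)

Section Classes.
Variables (T : Type) (r : T -> T -> Prop).
Hypotheses (r_refl : forall x, r x x) (r_sym : forall x y, r x y -> r y x)
  (r_trans : forall x y z, r x y -> r y z -> r x z).

Lemma cls_surj (X : quot r) : exists x, X = cls r x.
Proof. by case: X => A [x xA]; exists x; exact: eq_exist. Qed.

Lemma cls_rel x y : cls r x = cls r y -> r x y.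
Proof. by move=> /(congr1 (fun A => sval A y)) /= ->. Qed.

Lemma eq_cls x y : r x y -> cls r x = cls r y.
Proof.
move=> rxy; apply: eq_exist; apply/seteqP; split=> z; apply: r_trans => //.
exact: r_sym.
Qed.

(** Identities between hyperoperations are identities between subsets; they
    become identities between classes because a non-empty subset represents at
    most one class ([represents_unique]), and the class represented by an
    iterated composite is the iterated quotient operation
    ([represents_hlift]). *)
Definition represents (X : quot r) (A : set T) : Prop :=
  forall a, A a -> cls r a = X.

Lemma represents1 a : represents (cls r a) [set a].
Proof. by move=> _ ->. Qed.

Lemma represents_unique X Y A :
  A !=set0 -> represents X A -> represents Y A -> X = Y.
Proof. by move=> [a Aa] /(_ a Aa) <- /(_ a Aa). Qed.

Lemma represents_at X A a : represents X A -> A a -> cls r a = X.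
Proof. exact. Qed.

End Classes.

Lemma hlift_nonempty (S T U : Type) (op : S -> T -> set U) A B :
  (forall a b, op a b !=set0) -> A !=set0 -> B !=set0 -> hlift op A B !=set0.
Proof.
move=> op0 [a Aa] [b Bb]; have [c abc] := op0 a b.
by exists c; exists a => //; exists b.
Qed.

Section Induced.
Variables (S T U : Type) (r : S -> S -> Prop) (r' : T -> T -> Prop)
  (r'' : U -> U -> Prop) (op : S -> T -> set U).

(** It is enough that the class of a value depends only on the classes of the
    arguments; non-emptiness of the values provides the operation. *)
Lemma induced_exists :
  (forall x y, op x y !=set0) ->
  (forall x x' y y' z z', cls r x = cls r x' -> cls r' y = cls r' y' ->
     op x y z -> op x' y' z' -> cls r'' z = cls r'' z') ->
  exists qop : quot r -> quot r' -> quot r'', induced op qop.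
Proof.
move=> op0 opP.
have qopP (XY : quot r * quot r') : exists Z, forall x y z,
    XY.1 = cls r x -> XY.2 = cls r' y -> op x y z -> Z = cls r'' z.
  case: XY => X Y; have [x ->] := cls_surj X; have [y ->] := cls_surj Y.
  have [z xyz] := op0 x y; exists (cls r'' z) => x' y' z' /= xx' yy'.
  exact: opP xyz.
have [qop qopE] := choice qopP.
by exists (fun X Y => qop (X, Y)) => x y z; exact: qopE.
Qed.

Lemma represents_hlift (qop : quot r -> quot r' -> quot r'') X Y A B :
  induced op qop -> represents X A -> represents Y B ->
  represents (qop X Y) (hlift op A B).
Proof.
by move=> qopE AX BY z [a /AX <- [b /BY <- abz]]; rewrite (qopE _ _ _ abz).
Qed.

Lemma represents_op (qop : quot r -> quot r' -> quot r'') x y :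
  induced op qop -> represents (qop (cls r x) (cls r' y)) (op x y).
Proof. by move=> qopE z xyz; rewrite (qopE _ _ _ xyz). Qed.

End Induced.

(** * The operations on the quotient by S_n *)

Section CalSStar.
Variables (F : hyperfield) (L : lie_hyperalgebra F) (n : nat).
Local Notation add := (@hv_add F L).
Local Notation scale := (@hv_scale F L).
Local Notation br := (@lh_br F L).
Local Notation E := (@calS_star F L n).
Local Notation sum_pair := (sum_pair (@hderived F L n.-1)).

Lemma calS_star_sum_pair X X' x x' : sum_pair X X' -> X x -> X' x' -> E x x'.
Proof.
by move=> XX' Xx Xx'; apply/t_step/calSP;
  apply: rearranged_sub XX' => _ ->.
Qed.

Lemma calS_star_refl x : E x x.
Proof. by apply: (calS_star_sum_pair (sum_pair_refl _ x)). Qed.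

Lemma calS_star_sym x y : E x y -> E y x.
Proof.
elim=> {x y} [x y /calSP/sum_pair_sym/calSP|x y z _ yx _ zy]; first exact: t_step.
exact: t_trans zy yx.
Qed.

Lemma calS_star_trans x y z : E x y -> E y z -> E x z.
Proof. exact: t_trans. Qed.

Definition calS_cls_eq := eq_cls calS_star_sym calS_star_trans.
Definition calS_cls_rel x y := @cls_rel _ E calS_star_refl x y.

(** One step of [calS] is transported by [phi]; along a chain of steps,
    non-emptiness of the values of [phi] supplies the intermediate points. *)
Lemma cls_himage (phi : L -> set L) :
  (forall x, phi x !=set0) ->
  (forall X X', sum_pair X X' -> sum_pair (himage phi X) (himage phi X')) ->
  forall x y z z', cls E x = cls E y -> phi x z -> phi y z' -> cls E z = cls E z'.
Proof.
move=> phi0 phiP x y z z' /calS_cls_rel Exy xz yz'; apply: calS_cls_eq.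
elim: Exy z z' xz yz' => {x y} [x y /calSP/phiP xy|x w y _ IHx _ IHy] z z' xz yz'.
  by apply: calS_star_sum_pair xy _ _; [exists x | exists y].
by have [v wv] := phi0 w; apply: calS_star_trans (IHx _ _ xz wv) (IHy _ _ wv yz').
Qed.

Lemma hv_add_nonempty x y : add x y !=set0.
Proof. exact: hop_nonempty (@hv_add_semi F L) _ _ _ _. Qed.

Lemma cls_addC x y z z' : add x y z -> add y x z' -> cls E z = cls E z'.
Proof.
by move=> xyz yxz'; apply/calS_cls_eq/(calS_star_sum_pair (sum_pair_addC _ x y)).
Qed.

(** Only the right argument of a sum can be changed by adding a term in front,
    so the left argument is changed after commuting the two. *)
Lemma quotient_add_exists :
  exists qadd : quot E -> quot E -> quot E, induced add qadd.
Proof.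
apply: induced_exists => [|x x' y y' z z' xx' yy' xyz xyz'].
  exact: hv_add_nonempty.
have [v xyv] := hv_add_nonempty x y'; have [v' yxv] := hv_add_nonempty y' x.
have [w ywx] := hv_add_nonempty y' x'.
have addP := cls_himage (hv_add_nonempty _) (sum_pair_addl _).
rewrite (addP _ _ _ _ _ yy' xyz xyv) (cls_addC xyv yxv).
by rewrite (addP _ _ _ _ _ xx' yxv ywx) (cls_addC ywx xyz').
Qed.

Lemma quotient_scale_exists :
  exists qscale : alpha_quot F -> quot E -> quot E, induced scale qscale.
Proof.
apply: induced_exists => [|a b x y z z' ab xy axz byz'].
  exact: hv_scale_nonempty.
have [w ayw] := hv_scale_nonempty a y.
rewrite (cls_himage (hv_scale_nonempty a) (@sum_pair_scale _ _ _ a) xy axz ayw).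
apply: calS_cls_eq.
have {}ab : alpha_star a b.
  by apply: cls_rel ab => c; apply/t_step/alpha_refl.
elim: ab w z' ayw byz' {axz} => {a b} [a b ab|a c b _ IHa _ IHb] w z' ayw byz'.
  exact: calS_star_sum_pair (sum_pair_alpha _ y ab) ayw byz'.
have [v cyv] := hv_scale_nonempty c y.
exact: calS_star_trans (IHa _ _ ayw cyv) (IHb _ _ cyv byz').
Qed.

Lemma quotient_br_exists :
  exists qbr : quot E -> quot E -> quot E, induced br qbr.
Proof.
apply: induced_exists => [|x x' y y' z z' xx' yy' xyz xyz'].
  exact: lh_br_nonempty.
have [v xyv] := lh_br_nonempty x y'.
rewrite (cls_himage (lh_br_nonempty x) (@sum_pair_brr _ _ _ x) yy' xyz xyv).
exact: (@cls_himage (br^~ y') (fun a => lh_br_nonempty a y')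
  (@sum_pair_brl _ _ _ y') _ _ _ _ xx' xyv xyz').
Qed.

Definition quotient_add := sval (cid quotient_add_exists).
Definition quotient_scale := sval (cid quotient_scale_exists).
Definition quotient_br := sval (cid quotient_br_exists).

Lemma quotient_addE : induced add quotient_add.
Proof. exact: svalP (cid quotient_add_exists). Qed.

Lemma quotient_scaleE : induced scale quotient_scale.
Proof. exact: svalP (cid quotient_scale_exists). Qed.

Lemma quotient_brE : induced br quotient_br.
Proof. exact: svalP (cid quotient_br_exists). Qed.

End CalSStar.

(** Computes the class represented by an iterated composite, following its
    structure. *)
Ltac represent := repeat first
  [exact: represents1 | exact: quotient_addE | exact: quotient_scaleE
  | exact: quotient_brE | apply: represents_op | apply: represents_hlift].

Section QuotientAddition.
Variables (F : hyperfield) (L : lie_hyperalgebra F) (n : nat).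
Local Notation add := (@hv_add F L).
Local Notation E := (@calS_star F L n).
Local Notation quotient_add := (@quotient_add F L n).

Lemma quotient_addA : associative quotient_add.
Proof.
move=> X Y Z; have [x ->] := cls_surj X; have [y ->] := cls_surj Y.
have [z ->] := cls_surj Z.
apply: (@represents_unique _ _ _ _ (hlift add [set x] (add y z))).
- by apply: hlift_nonempty;
    [exact: hv_add_nonempty | exists x | exact: hv_add_nonempty].
- by represent.
rewrite -(hop_assoc (@hv_add_semi F L)) //.
by represent.
Qed.

Lemma quotient_addC : commutative quotient_add.
Proof.
move=> X Y; have [x ->] := cls_surj X; have [y ->] := cls_surj Y.
have [z xyz] := hv_add_nonempty x y; have [w yxw] := hv_add_nonempty y x.
by rewrite (quotient_addE n xyz) (quotient_addE n yxw); apply: cls_addC xyz yxw.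
Qed.

Lemma quotient_add0 : left_id (cls E (hv_zero L)) quotient_add.
Proof.
move=> X; have [x ->] := cls_surj X.
by apply: quotient_addE; rewrite (hv_addP x).1.
Qed.

(** Reproducibility: zero lies in [y + x] for some [y]. *)
Lemma quotient_opp_exists X : exists Y, quotient_add Y X = cls E (hv_zero L).
Proof.
have [x ->] := cls_surj X.
have : hlift add setT [set x] (hv_zero L).
  by rewrite (hypergroup_repror (hv_hypergroup L)).
by move=> [y _ [_ -> yx0]]; exists (cls E y); apply: quotient_addE.
Qed.

Definition quotient_opp X := sval (cid (quotient_opp_exists X)).

Lemma quotient_addN : left_inverse (cls E (hv_zero L)) quotient_opp quotient_add.
Proof. by move=> X; exact: svalP (cid (quotient_opp_exists X)). Qed.

End QuotientAddition.

Section QuotientModule.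
Variables (F : hyperfield) (cK : GRing.Field (alpha_quot F)).
Hypothesis hK : quotient_field cK.
Local Notation K := (GRing.Field.Pack cK).
Variables (L : lie_hyperalgebra F) (n : nat).
Local Notation add := (@hv_add F L).
Local Notation scale := (@hv_scale F L).
Local Notation E := (@calS_star F L n).
Local Notation br := (@lh_br F L).
Local Notation qscale := (@quotient_scale F L n : K -> _ -> _).
Local Notation qadd := (@quotient_add F L n).
Local Notation cl := (@cls F (@alpha_star F)).

Local Open Scope ring_scope.

(** The unit of [F] is only a weak unit, [a] being a member of [1 a]; on classes
    this is enough. *)
Lemma cls_one : cl (hf_one F) = 1 :> K.
Proof.
have [a a1] := cls_surj (1 : K).
rewrite -[LHS](@mulr1 K) a1; apply: hK.2; exact: (hf_oneP a).1.
Qed.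

Lemma quotient_scaleA a b X : qscale a (qscale b X) = qscale (a * b) X.
Proof.
have [a' ->] := cls_surj (a : alpha_quot F).
have [b' ->] := cls_surj (b : alpha_quot F); have [x ->] := cls_surj X.
apply: (@represents_unique _ _ _ _ (hlift scale [set a'] (scale b' x))).
- by apply: hlift_nonempty;
    [exact: hv_scale_nonempty | exists a' | exact: hv_scale_nonempty].
- by represent.
rewrite -hv_scaleA.
by represent; exact: hK.2.
Qed.

Lemma quotient_scale1 : left_id 1 qscale.
Proof.
move=> X; have [x ->] := cls_surj X; rewrite -cls_one.
by apply: quotient_scaleE; rewrite hv_scale1.
Qed.

Lemma quotient_scaleDr : right_distributive qscale qadd.
Proof.
move=> a X Y; have [a' ->] := cls_surj (a : alpha_quot F).
have [x ->] := cls_surj X; have [y ->] := cls_surj Y.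
apply: (@represents_unique _ _ _ _ (hlift scale [set a'] (add x y))).
- by apply: hlift_nonempty;
    [exact: hv_scale_nonempty | exists a' | exact: hv_add_nonempty].
- by represent.
rewrite hv_scaleDr.
by represent.
Qed.

Lemma quotient_scaleDl X : {morph qscale^~ X : a b / a + b >-> qadd a b}.
Proof.
move=> a b; have [a' ->] := cls_surj (a : alpha_quot F).
have [b' ->] := cls_surj (b : alpha_quot F); have [x ->] := cls_surj X.
apply: (@represents_unique _ _ _ _ (hlift add (scale a' x) (scale b' x))).
- by apply: hlift_nonempty; [exact: hv_add_nonempty
    | exact: hv_scale_nonempty | exact: hv_scale_nonempty].
- rewrite -hv_scaleDl.
  by represent; exact: hK.1.
by represent.
Qed.

(** The carrier is the set of classes.  The first argument is a label: the
    module structure below depends on it, so it must occur in the type for that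
    structure to be inferred. *)
Definition lie_quotient (_ : quotient_field cK) (L' : lie_hyperalgebra F) (n' : nat) :
  Type := calS_quot L' n'.
Local Notation Q := (lie_quotient hK L n).

HB.instance Definition _ := gen_eqMixin Q.
HB.instance Definition _ := gen_choiceMixin Q.
HB.instance Definition _ := GRing.isZmodule.Build Q
  (@quotient_addA F L n) (@quotient_addC F L n) (@quotient_add0 F L n)
  (@quotient_addN F L n).
HB.instance Definition _ := GRing.Zmodule_isLmodule.Build K Q
  quotient_scaleA quotient_scale1 quotient_scaleDr quotient_scaleDl.
Local Notation V := (Q : lmodType K).

Lemma quotient_lie_algebra : @lie_algebra K V (@quotient_br F L n).
Proof.
split.
- move=> a b X1 X2 Y; have [a' ->] := cls_surj (a : alpha_quot F).
  have [b' ->] := cls_surj (b : alpha_quot F); have [x1 ->] := cls_surj X1.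
  have [x2 ->] := cls_surj X2; have [y ->] := cls_surj Y.
  apply: (@represents_unique _ _ _ _ (hlift br
    (hlift add (scale a' x1) (scale b' x2)) [set y])).
  + apply: hlift_nonempty; [exact: lh_br_nonempty | | by exists y].
    by apply: hlift_nonempty; [exact: hv_add_nonempty | exact: hv_scale_nonempty
                              | exact: hv_scale_nonempty].
  + by represent.
  by rewrite lh_br_linearl; represent.
- move=> a b Y X1 X2; have [a' ->] := cls_surj (a : alpha_quot F).
  have [b' ->] := cls_surj (b : alpha_quot F); have [x1 ->] := cls_surj X1.
  have [x2 ->] := cls_surj X2; have [y ->] := cls_surj Y.
  apply: (@represents_unique _ _ _ _ (hlift br [set y]
    (hlift add (scale a' x1) (scale b' x2)))).
  + apply: hlift_nonempty; [exact: lh_br_nonempty | by exists y | ].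
    by apply: hlift_nonempty; [exact: hv_add_nonempty | exact: hv_scale_nonempty
                              | exact: hv_scale_nonempty].
  + by represent.
  by rewrite lh_br_linearr; represent.
- move=> X; have [x ->] := cls_surj X.
  by apply: quotient_brE; exact: lh_br_alt.
move=> X Y Z; have [x ->] := cls_surj X; have [y ->] := cls_surj Y.
have [z ->] := cls_surj Z; apply/esym.
by apply: (represents_at _ (lh_jacobi x y z)); represent.
Qed.

End QuotientModule.

(** * Solvability *)

Section DerivedSeries.
Variables (K : fieldType) (V : lmodType K) (br : V -> V -> V).
Hypothesis brL : lie_algebra br.
Local Open Scope ring_scope.

Lemma lspan_subspace (A : set V) : subspace (lspan A).
Proof.
split=> [|a u v Au Av] W [subW AW]; first exact: subW.1.
by apply: subW.2; [apply: Au | apply: Av].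
Qed.

Lemma br_combl a x y w : br (a *: x + y) w = a *: br x w + br y w.
Proof. by have := lie_linearl brL a 1 x y w; rewrite !scale1r. Qed.

Lemma br_combr a x y w : br w (a *: x + y) = a *: br w x + br w y.
Proof. by have := lie_linearr brL a 1 w x y; rewrite !scale1r. Qed.

(** Used twice: with [W] a span of brackets to follow the derived series, and
    with [W] the zero subspace at its last step. *)
Lemma br_lspan (A W : set V) : subspace W ->
  (forall x y, A x -> A y -> W (br x y)) ->
  forall u v, lspan A u -> lspan A v -> W (br u v).
Proof.
move=> [W0 WD] AW u v.
have br0l w : br 0 w = 0.
  by have := lie_linearl brL 0 0 0 0 w; rewrite !scale0r !addr0.
have br0r w : br w 0 = 0.
  by have := lie_linearr brL 0 0 w 0 0; rewrite !scale0r !addr0.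
have AspanW x : A x -> lspan A `<=` [set w | W (br x w)].
  move=> Ax; apply: smallest_sub => [|y Ay]; last exact: AW.
  by split=> [|a y z Wy Wz] /=; rewrite ?br0r ?br_combr //; apply: WD.
move=> Au Av; move: u Au; apply: smallest_sub => [|x Ax]; last exact: AspanW.
by split=> [|a y z Wy Wz] /=; rewrite ?br0l ?br_combl //; apply: WD.
Qed.

Lemma br_skew u v : br u v = - br v u.
Proof.
apply/eqP; rewrite -addr_eq0; apply/eqP.
have := lie_alt brL (1 *: u + v).
by rewrite br_combl !br_combr !(lie_alt brL) !scale1r add0r addr0.
Qed.

Lemma br_symm_eq0 u v : 2%N \notin [pchar K] -> br u v = br v u -> br u v = 0.
Proof.
rewrite inE /= => two_neq0 uv; apply/eqP.
have: 2%:R *: br u v == 0.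
  by rewrite scaler_nat mulr2n {2}uv (br_skew v u) subrr.
by rewrite scaler_eq0 (negPf two_neq0).
Qed.

End DerivedSeries.

Section Solvability.
Variables (F : hyperfield) (cK : GRing.Field (alpha_quot F)).
Hypothesis hK : quotient_field cK.
Local Notation K := (GRing.Field.Pack cK).
Hypothesis two_neq0 : 2%N \notin [pchar K]%R.
Variables (L : lie_hyperalgebra F) (n : nat).
Local Notation V := (lie_quotient hK L n : lmodType K).
Local Notation E := (@calS_star F L n).
Local Notation qbr := (@quotient_br F L n).
Local Notation derived_classes i := ([set cls E x | x in @hderived F L i]).

(** Brackets of combinations of classes are combinations of brackets of
    classes, and those are classes of elements of the next derived subset. *)
Lemma lie_derived_sub i :
  @lie_derived K V qbr i `<=` @lspan K V (derived_classes i).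
Proof.
elim: i => [|i IHi] /=.
  move=> X _; apply: sub_gen_smallest.
  by have [x ->] := cls_surj X; exists x.
apply: smallest_sub; first exact: lspan_subspace.
move=> _ [u /IHi Du [v /IHi Dv <-]].
apply: (br_lspan (quotient_lie_algebra hK L n) (lspan_subspace _) _ Du Dv).
move=> _ _ [x Dx <-] [y Dy <-]; apply: sub_gen_smallest.
have [z xyz] := lh_br_nonempty x y.
exists z; last by rewrite (quotient_brE n xyz).
by exists x => //; exists y.
Qed.

Lemma quotient_solvable : (0 < n)%N -> @solvable_length_le K V qbr n.
Proof.
move=> n_gt0; rewrite /solvable_length_le.
suff: @lie_derived K V qbr n.-1.+1 = [set 0%R] by rewrite (prednK n_gt0).
apply/seteqP; split=> /=; last by move=> _ ->; exact: (@lspan_subspace K V _).1.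
have sub0 : @subspace K V [set 0%R].
  by split=> // a u v -> ->; rewrite scaler0 addr0.
apply: smallest_sub => // _ [u /lie_derived_sub Du [v /lie_derived_sub Dv <-]].
apply: (br_lspan (quotient_lie_algebra hK L n) sub0 _ Du Dv).
move=> _ _ [x Dx <-] [y Dy <-].
apply: (br_symm_eq0 (quotient_lie_algebra hK L n) two_neq0).
have [z xyz] := lh_br_nonempty x y; have [w yxw] := lh_br_nonempty y x.
rewrite (quotient_brE n xyz) (quotient_brE n yxw); apply: calS_cls_eq.
apply: calS_star_sum_pair _ xyz yxw.
exact/rearranged_base/mono_pair_swap.
Qed.

End Solvability.

Theorem theorem3p3 (F : hyperfield)
    (cK : GRing.Field (alpha_quot F))
    (hK : quotient_field cK)
    (hchar : 2%N \notin [pchar (GRing.Field.Pack cK)]%R)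
    (L : lie_hyperalgebra F) (n : nat) (hn : (0 < n)%N) :
  exists (cV : GRing.Lmodule (GRing.Field.Pack cK) (calS_quot L n))
         (br : calS_quot L n -> calS_quot L n -> calS_quot L n),
    [/\ quotient_operations cV br,
        @lie_algebra (GRing.Field.Pack cK) (GRing.Lmodule.Pack cV) br
      & @solvable_length_le (GRing.Field.Pack cK) (GRing.Lmodule.Pack cV) br n].
Proof.
exists (GRing.Lmodule.class (lie_quotient hK L n : lmodType _)).
exists (@quotient_br F L n).
split; [|exact: quotient_lie_algebra|exact: quotient_solvable].
split; [exact: quotient_addE|exact: quotient_scaleE|exact: quotient_brE].
Qed.
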